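(* Let $k$ be an algebraically closed field and $A$ a finite-dimensional unital associative $k$-algebra. The completely join-irreducible elements of the lattice $\mathcal{L}_t(A)$ of pretorsion classes of $\mathrm{mod}\,A$ coincide (as a set of subcategories of $\mathrm{mod}\,A$) with the completely join-irreducible elements of the lattice $\mathrm{tors}\,A$ of torsion classes of $\mathrm{mod}\,A$ if and only if $A$ is a locally representation directed algebra.
   Context: $\mathrm{mod}\,A$ is the category of finitely generated right $A$-modules. All subcategories are full and closed under isomorphisms. A pretorsion class of $\mathrm{mod}\,A$ is a subcategory containing $0$ and closed under quotients and finite direct sums; a torsion class is a pretorsion class that is also closed under extensions. $\mathcal{L}_t(A)$ and $\mathrm{tors}\,A$ denote the sets of pretorsion classes and of torsion classes of $\mathrm{mod}\,A$, respectively, ordered by inclusion; both are complete lattices (and $\mathrm{tors}\,A$ is a subposet, in general not a sublattice, of $\mathcal{L}_t(A)$). An element $x$, different from the bottom element, of a lattice $\mathcal{L}$ is completely join-irreducible if there is $x_0\in\mathcal{L}$, $x_0\neq x$, such that for every $a\in\mathcal{L}$, $a<x$ if and only if $a\leq x_0$. An $A$-module $M$ is a brick if $\mathrm{End}_A(M)$ is a division ring (equivalently $\mathrm{End}_A(M)\cong k$). $A$ is locally representation directed if every indecomposable module in $\mathrm{mod}\,A$ is a brick. *)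

(* Defs.v *)
From HB Require Import structures.
From mathcomp Require Import all_boot all_order all_algebra all_field.

Set Implicit Arguments.
Unset Strict Implicit.
Unset Printing Implicit Defensive.

Import GRing.Theory.
Local Open Scope ring_scope.

(* A right R-module is a left module over the converse ring R^c: the right
   action x . a is written a *: x, so that x . (a * b) = (x . a) . b. *)
Notation rmodType R := (lmodType R^c).

Section RightModules.
Variable R : pzRingType.
Implicit Types L M N : rmodType R.

Definition finitely_generated M : Prop :=
  exists n (e : 'I_n -> M), forall x : M,
    exists c : 'I_n -> R^c, x = \sum_(i < n) c i *: e i.

Definition zero_module M : Prop := forall x : M, x = 0.

Definition isomorphic M N : Prop := exists f : {linear M -> N}, bijective f.

Definition quotient_of M N : Prop :=
  exists f : {linear M -> N}, forall y : N, exists x : M, f x = y.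

(* 0 -> L -> M -> N -> 0 is exact for some choice of the maps. *)
Definition extension_of L N M : Prop :=
  exists (f : {linear L -> M}) (g : {linear M -> N}),
    [/\ injective f,
        forall y : M, g y = 0 <-> exists x : L, f x = y
      & forall z : N, exists y : M, g y = z].

Definition indecomposable M : Prop :=
  ~ zero_module M /\
  forall N1 N2, isomorphic M (N1 * N2)%type ->
    zero_module N1 \/ zero_module N2.

(* End(M) is a division ring: 1 <> 0 (i.e. M is nonzero), and every nonzero
   element has a two-sided inverse. *)
Definition brick M : Prop :=
  ~ zero_module M /\
  forall f : {linear M -> M}, ~ (forall x, f x = 0) ->
    exists g : {linear M -> M}, cancel f g /\ cancel g f.

End RightModules.

(* A full subcategory is given by its class of objects, and two of them are
   equal when they have the same objects. *)
Definition subcat (R : pzRingType) := rmodType R -> Prop.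

Section Subcategories.
Variable R : pzRingType.
Implicit Types T S X Y : subcat R.

Definition subcat_le T S : Prop := forall M, T M -> S M.
Definition subcat_eq T S : Prop := forall M, T M <-> S M.
Definition subcat_lt T S : Prop := subcat_le T S /\ ~ subcat_eq T S.

Definition subcategory_of_mod T : Prop :=
  (forall M, T M -> finitely_generated M) /\
  (forall M N, isomorphic M N -> T M -> T N).

Definition pretorsion_class T : Prop :=
  [/\ subcategory_of_mod T,
      forall M, zero_module M -> T M,
      forall M N, quotient_of M N -> T M -> T N
    & forall M N, T M -> T N -> T (M * N)%type].

Definition torsion_class T : Prop :=
  pretorsion_class T /\
  forall L M N, extension_of L N M -> T L -> T N -> T M.

(* X is completely join-irreducible in the family C of subcategories ordered
   by inclusion. *)
Definition completely_join_irreducible (C : subcat R -> Prop) X : Prop :=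
  [/\ C X,
      ~ (forall Y, C Y -> subcat_le X Y)
    & exists X0, [/\ C X0, ~ subcat_eq X0 X
        & forall Y, C Y -> (subcat_lt Y X <-> subcat_le Y X0)]].

Definition locally_representation_directed : Prop :=
  forall M : rmodType R, finitely_generated M -> indecomposable M -> brick M.

End Subcategories.

Arguments pretorsion_class : clear implicits.
Arguments torsion_class : clear implicits.

(* Main.v *)
(* For M indecomposable, End(M) is local with nilpotent radical, so M is not the
   sum of the images of its non-isomorphisms. Hence a module N of Fac M
   generates M only if M is a summand of N, and the modules of Fac M that do not
   generate M form the largest pretorsion class properly contained in Fac M. So
   the completely join-irreducible pretorsion classes are exactly the classes
   Fac M with M indecomposable, and Fac M determines M.
   If all indecomposables are bricks, then Ext^1(M, Fac M) = 0 for every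
   indecomposable M, so that Fac M, and the class just described, are torsion
   classes, and both families consist of the classes Fac M.
   Conversely, a completely join-irreducible torsion class X contains a brick B
   outside its lower cover. If X = Fac M and Fac B is also a torsion class, then
   Fac B = Fac M, so M is isomorphic to the brick B. *)
From HB Require Import structures.
Require Import Defs.
From mathcomp Require Import all_boot all_order all_algebra all_field.
From mathcomp Require Import boolp.

Set Implicit Arguments.
Unset Strict Implicit.
Unset Printing Implicit Defensive.

Import GRing.Theory.
Local Open Scope ring_scope.

(** * Linear maps, submodules and quotients *)

Section Linear.
Variable R : pzRingType.
Implicit Types L M N : lmodType R.

Definition linear_pack M N (f : M -> N) (f_lin : linear f) : {linear M -> N} :=
  HB.pack f (GRing.isLinear.Build _ _ _ _ f f_lin).

Definition is_submodule M (P : M -> Prop) : Prop :=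
  P 0 /\ forall a x y, P x -> P y -> P (a *: x + y).

Definition surj M N (f : M -> N) : Prop := forall y, exists x, f x = y.

Lemma submoduleD M (P : M -> Prop) x y :
  is_submodule P -> P x -> P y -> P (x + y).
Proof. by move=> [_ PD] Px Py; have := PD 1 x y Px Py; rewrite scale1r. Qed.

Lemma submoduleZ M (P : M -> Prop) a x : is_submodule P -> P x -> P (a *: x).
Proof. by move=> [P0 PD] Px; have := PD a x 0 Px P0; rewrite addr0. Qed.

Lemma submoduleN M (P : M -> Prop) x : is_submodule P -> P x -> P (- x).
Proof. by move=> sP Px; rewrite -scaleN1r; apply: submoduleZ. Qed.

Lemma submodule_sum M (P : M -> Prop) I (r : seq I) (F : I -> M) :
  is_submodule P -> (forall i, P (F i)) -> P (\sum_(i <- r) F i).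
Proof.
move=> sP PF; elim/big_ind: _ => //; first by case: sP.
by move=> x y; apply: submoduleD.
Qed.

Lemma preimage_submodule M N (f : {linear M -> N}) (P : N -> Prop) :
  is_submodule P -> is_submodule (fun x => P (f x)).
Proof.
move=> [P0 PD]; split=> [|a x y Px Py]; first by rewrite linear0.
by rewrite linearP; apply: PD.
Qed.

Lemma image_submodule M N (f : {linear M -> N}) (P : M -> Prop) :
  is_submodule P -> is_submodule (fun y => exists2 x, P x & f x = y).
Proof.
move=> [P0 PD]; split=> [|a _ _ [x Px <-] [y Py <-]].
  by exists 0; rewrite ?linear0.
by exists (a *: x + y); rewrite ?linearP //; apply: PD.
Qed.

Lemma zero_submodule M : is_submodule (fun x : M => x = 0).
Proof. by split=> // a x y -> ->; rewrite scaler0 addr0. Qed.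

Lemma ker_submodule M N (f : {linear M -> N}) :
  is_submodule (fun x => f x = 0).
Proof. exact: preimage_submodule f _ (zero_submodule N). Qed.

Lemma im_submodule M N (f : {linear M -> N}) :
  is_submodule (fun y => exists x, f x = y).
Proof.
split=> [|a _ _ [x <-] [y <-]]; first by exists 0; rewrite linear0.
by exists (a *: x + y); rewrite linearP.
Qed.

Lemma ker0_inj M N (f : {linear M -> N}) :
  (forall x, f x = 0 -> x = 0) -> injective f.
Proof.
by move=> f0 x y fxy; apply/subr0_eq/f0; rewrite linearB fxy subrr.
Qed.

Lemma inj_ker0 M N (f : {linear M -> N}) x : injective f -> f x = 0 -> x = 0.
Proof. by move=> fI fx0; apply: fI; rewrite fx0 linear0. Qed.

Lemma not_inj_ker M N (f : {linear M -> N}) :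
  ~ injective f -> exists2 x, f x = 0 & x <> 0.
Proof.
move=> fNI; apply: contrapT => H; apply/fNI/ker0_inj => x fx0.
by apply: contrapT => x0; apply: H; exists x.
Qed.

(** A set-theoretic section [s] of [p] is linear up to [ker p], which [h] kills, so [h \o s] is
    linear. *)
Lemma factor_through M N L (p : {linear M -> N}) (h : {linear M -> L}) :
  surj p -> (forall x, p x = 0 -> h x = 0) ->
  exists g : {linear N -> L}, forall x, g (p x) = h x.
Proof.
move=> /choice[s sK] kerh.
have hs x : h (s (p x)) = h x.
  by apply/subr0_eq; rewrite -linearB; apply: kerh; rewrite linearB sK subrr.
have lin : linear (h \o s).
  move=> a x y /=; rewrite -linearP; apply/subr0_eq; rewrite -linearB.
  by apply: kerh; rewrite linearB linearP !sK subrr.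
by exists (linear_pack lin).
Qed.

Lemma linear_inverse M N (f : {linear M -> N}) :
  injective f -> surj f -> exists g : {linear N -> M}, cancel f g /\ cancel g f.
Proof.
move=> fI fS.
have [|g gK] := @factor_through _ _ _ f (idfun : {linear M -> M}) fS.
  by move=> x /(inj_ker0 fI).
exists g; split=> // y; have [x <-] := fS y; by rewrite gK.
Qed.

Lemma inj_surj_bij M N (f : {linear M -> N}) :
  injective f -> surj f -> bijective f.
Proof.
by move=> fI /(linear_inverse fI)[g [fK gK]]; exists g.
Qed.

Lemma bij_surj M N (f : M -> N) : bijective f -> surj f.
Proof. by case=> g _ gK y; exists (g y). Qed.

Lemma sum_proj M N (x : M) (y : N) : (x, y) = (x, 0) + (0, y) :> (M * N)%type.
Proof. by rewrite /GRing.add /= /add_pair /= addr0 add0r. Qed.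

Lemma inl_linear M N : linear (fun x : M => (x, 0) : (M * N)%type).
Proof. by move=> a x y; congr (_, _); rewrite /= scaler0 addr0. Qed.

Lemma inr_linear M N : linear (fun y : N => (0, y) : (M * N)%type).
Proof. by move=> a x y; congr (_, _); rewrite /= scaler0 addr0. Qed.

Definition inlm M N := linear_pack (@inl_linear M N).
Definition inrm M N := linear_pack (@inr_linear M N).

Lemma pair_linear M N L (f : {linear L -> M}) (g : {linear L -> N}) :
  linear (fun x => (f x, g x) : (M * N)%type).
Proof. by move=> a x y; congr (_, _); rewrite linearP. Qed.

Definition pairm M N L (f : {linear L -> M}) (g : {linear L -> N}) :=
  linear_pack (pair_linear f g).

Lemma copair_linear M N L (f : {linear M -> L}) (g : {linear N -> L}) :
  linear (fun z : (M * N)%type => f z.1 + g z.2).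
Proof.
by move=> a [x1 x2] [y1 y2] /=; rewrite !linearP scalerDr addrACA.
Qed.

Definition copairm M N L (f : {linear M -> L}) (g : {linear N -> L}) :
  {linear (M * N)%type -> L} := linear_pack (copair_linear f g).

End Linear.

(** * Submodules as modules *)

Section Submodule.
Variables (R : pzRingType) (M : lmodType R) (P : M -> Prop).
Hypothesis sP : is_submodule P.

(** The proof is an argument so that the closure structure can be attached to this predicate as a
    canonical instance. *)
Definition submodule_pred of is_submodule P := [pred x : M | `[< P x >]].

Fact submodule_pred_closed : subsemimod_closed (submodule_pred sP).
Proof.
case: sP => P0 PD; split; last first.
  by move=> a x /asboolP Px; apply/asboolP; apply: submoduleZ.
split; first exact/asboolP.
move=> x y /asboolP Px /asboolP Py; apply/asboolP; exact: submoduleD.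
Qed.

HB.instance Definition _ :=
  GRing.isSubmodClosed.Build R M (submodule_pred sP) submodule_pred_closed.

Definition submodule_type := {x : M | x \in submodule_pred sP}.
HB.instance Definition _ := SubChoice.on submodule_type.
HB.instance Definition _ :=
  [SubChoice_isSubLmodule of submodule_type by <:].

Lemma submodule_exists :
  exists (U : lmodType R) (i : {linear U -> M}),
    injective i /\ forall x, P x <-> exists u, i u = x.
Proof.
exists submodule_type, (\val : {linear submodule_type -> M}).
split=> [|x]; first exact: val_inj.
split=> [Px|[u <-]]; last exact/asboolP/(valP u).
have xP : x \in submodule_pred sP by apply/asboolP.
by exists (exist _ x xP).
Qed.

End Submodule.

(** * Quotient modules *)

Section Quotient.
Local Open Scope quotient_scope.
Variables (R : pzRingType) (M : lmodType R) (P : M -> Prop).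
Hypothesis sP : is_submodule P.

Definition quotient_rel of is_submodule P := fun x y : M => `[< P (x - y) >].

Fact quotient_rel_equiv : equiv_class_of (quotient_rel sP).
Proof.
split=> [x|x y|y x z]; first by apply/asboolP; rewrite subrr; case: sP.
  by apply/asboolP/asboolP => /(submoduleN sP); rewrite opprB.
move=> /asboolP Pxy /asboolP Pyz; apply/asboolP.
by rewrite -(subrKA y); apply: submoduleD.
Qed.

Canonical quotient_equiv := EquivRelPack quotient_rel_equiv.

Definition quotient_type := {eq_quot quotient_rel sP}.
HB.instance Definition _ := Choice.on quotient_type.
Definition qpi (x : M) : quotient_type := \pi_({eq_quot quotient_rel sP}) x.
Definition qrep (x : quotient_type) : M := repr x.

Lemma qpiE x y : qpi x = qpi y <-> P (x - y).
Proof. by split=> [/eqmodP/asboolP|Pxy] //; apply/eqmodP/asboolP. Qed.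

Lemma qrepK x : qpi (qrep x) = x. Proof. exact: reprK. Qed.

Lemma qrepP x : P (qrep (qpi x) - x). Proof. by apply/qpiE/qrepK. Qed.

Lemma qpiP (T : quotient_type -> Prop) : (forall x, T (qpi x)) -> forall x, T x.
Proof. by move=> H x; rewrite -(qrepK x). Qed.

Definition qadd x y := qpi (qrep x + qrep y).
Definition qopp x := qpi (- qrep x).
Definition qscale a x := qpi (a *: qrep x).

Lemma qaddE x y : qadd (qpi x) (qpi y) = qpi (x + y).
Proof.
apply/qpiE; rewrite opprD addrACA.
by apply: submoduleD => //; apply: qrepP.
Qed.

Lemma qoppE x : qopp (qpi x) = qpi (- x).
Proof.
by apply/qpiE; rewrite -opprD; apply: submoduleN => //; apply: qrepP.
Qed.

Lemma qscaleE a x : qscale a (qpi x) = qpi (a *: x).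
Proof.
by apply/qpiE; rewrite -scalerBr; apply: submoduleZ => //; apply: qrepP.
Qed.

Fact qaddA : associative qadd.
Proof.
by elim/qpiP=> x; elim/qpiP=> y; elim/qpiP=> z; rewrite !qaddE addrA.
Qed.
Fact qaddC : commutative qadd.
Proof. by elim/qpiP=> x; elim/qpiP=> y; rewrite !qaddE addrC. Qed.
Fact qadd0 : left_id (qpi 0) qadd.
Proof. by elim/qpiP=> x; rewrite !qaddE add0r. Qed.
Fact qaddN : left_inverse (qpi 0) qopp qadd.
Proof. by elim/qpiP=> x; rewrite qoppE !qaddE addNr. Qed.

HB.instance Definition _ :=
  GRing.isZmodule.Build quotient_type qaddA qaddC qadd0 qaddN.

Fact qscaleA a b x : qscale a (qscale b x) = qscale (a * b) x.
Proof. by elim/qpiP: x => x; rewrite !qscaleE scalerA. Qed.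
Fact qscale1 : left_id 1 qscale.
Proof. by elim/qpiP=> x; rewrite !qscaleE scale1r. Qed.
Fact qscaleDr : right_distributive qscale +%R.
Proof.
move=> a; elim/qpiP=> x; elim/qpiP=> y.
by rewrite [qpi x + _]qaddE !qscaleE scalerDr -qaddE.
Qed.
Fact qscaleDl x : {morph qscale^~ x : a b / a + b}.
Proof. by elim/qpiP: x => x a b; rewrite !qscaleE scalerDl -qaddE. Qed.

HB.instance Definition _ :=
  GRing.Zmodule_isLmodule.Build R quotient_type
    qscaleA qscale1 qscaleDr qscaleDl.

Fact qpi_linear : linear (qpi : M -> quotient_type).
Proof. by move=> a x y; rewrite -qaddE -qscaleE. Qed.

Lemma quotient_exists :
  exists (Q : lmodType R) (p : {linear M -> Q}),
    surj p /\ forall x, p x = 0 <-> P x.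
Proof.
exists quotient_type, (linear_pack qpi_linear).
split=> [|x]; first by elim/qpiP=> x; exists x.
by rewrite -[X in _ <-> P X]subr0; apply: qpiE.
Qed.

End Quotient.

(** * Traces and the classes Fac M *)

Section Generation.
Variable R : pzRingType.
Implicit Types L M N : rmodType R.

(** Replaces coefficients by an induction principle over submodules, which transfers along preimages
    and images of linear maps. *)
Lemma finitely_generatedP M :
  finitely_generated M <->
  exists n (e : 'I_n -> M), forall P : M -> Prop,
    is_submodule P -> (forall i, P (e i)) -> forall x, P x.
Proof.
split=> -[n [e eP]]; exists n, e.
  move=> P sP Pe x; have [c ->] := eP x.
  by apply: submodule_sum => // i; apply: submoduleZ.
apply: eP => [|i].
  split=> [|a _ _ [c ->] [d ->]].
    by exists (fun=> 0); rewrite big1 // => i _; rewrite scale0r.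
  exists (fun i => a * c i + d i); rewrite scaler_sumr -big_split /=.
  by apply: eq_bigr => i _; rewrite scalerDl scalerA.
exists (fun j => (j == i)%:R); rewrite (bigD1 i) //= eqxx scale1r.
by rewrite big1 ?addr0 // => j /negPf->; rewrite scale0r.
Qed.

Lemma fg_zero M : zero_module M -> finitely_generated M.
Proof.
move=> M0; exists 0%N, (fun=> 0) => x; exists (fun=> 0).
by rewrite big_ord0 (M0 x).
Qed.

Lemma fg_quotient M N :
  quotient_of M N -> finitely_generated M -> finitely_generated N.
Proof.
move=> [f fS] /finitely_generatedP[n [e eP]]; apply/finitely_generatedP.
exists n, (f \o e) => P sP Pe y; have [x <-] := fS y.
exact: (eP _ (preimage_submodule f sP)).
Qed.

Lemma fg_extension L N M : extension_of L N M ->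
  finitely_generated L -> finitely_generated N -> finitely_generated M.
Proof.
move=> [f [g [_ exg gS]]] /finitely_generatedP[n [e eP]].
move=> /finitely_generatedP[m [d dP]]; have [s sK] := choice gS.
apply/finitely_generatedP; exists (n + m)%N.
exists (fun i => match split i with inl j => f (e j) | inr j => s (d j) end).
move=> P sP Pe; have Pf x : P (f x).
  apply: (eP _ (preimage_submodule f sP)) => i.
  by have := Pe (lshift m i); rewrite (unsplitK (inl i)).
(* The lifts [s (d i)] need only generate [N] after applying [g]; the remaining error lies in the
   image of [f]. *)
have gP z : exists2 y, P y & g y = z.
  apply: (dP _ (image_submodule g sP)) => i; exists (s (d i)) => //.
  by have := Pe (rshift n i); rewrite (unsplitK (inr i)).
move=> x; have [y Py gyx] := gP (g x); have [u fu] : exists u, f u = x - y.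
  by apply/exg; rewrite linearB gyx subrr.
by rewrite -(subrK y x) -fu; apply: submoduleD.
Qed.

Lemma prod_extension M N : extension_of M N (M * N)%type.
Proof.
exists (inlm M N), (snd : {linear (M * N)%type -> N}); split.
- by move=> x y [].
- move=> [x y] /=; split=> [->|[z [_ <-]]] //; by exists x.
- by move=> z; exists (0, z).
Qed.

Lemma fg_prod M N :
  finitely_generated M -> finitely_generated N ->
  finitely_generated (M * N)%type.
Proof. exact/fg_extension/prod_extension. Qed.

Lemma quotient_of_iso M N : isomorphic M N -> quotient_of M N.
Proof. by move=> [f /bij_surj fS]; exists f. Qed.

(* The trace of M in N, i.e. the sum of the images of all maps M -> N. *)
Definition trace M N (x : N) : Prop :=
  forall P : N -> Prop,
    is_submodule P -> (forall (f : {linear M -> N}) m, P (f m)) -> P x.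

(** Equivalently, [N] is a quotient of a direct sum of copies of [M]; finitely many copies suffice
    when [N] is finitely generated. *)
Definition gen M N : Prop := forall x : N, trace M x.

Definition fac M : subcat R := fun N => finitely_generated N /\ gen M N.

Lemma trace_submodule M N : is_submodule (@trace M N).
Proof.
split=> [P [P0 _] _ //|a x y tx ty P sP Pf].
by apply: submoduleD => //; [apply: submoduleZ => //; apply: tx|apply: ty].
Qed.

Lemma trace_im M N (f : {linear M -> N}) m : trace M (f m).
Proof. by move=> P _; apply. Qed.

Lemma trace_map M N L (g : {linear N -> L}) x : trace M x -> trace M (g x).
Proof.
move=> tx P sP Pf; apply: (tx _ (preimage_submodule g sP)) => f m.
exact: (Pf (g \o f : {linear _ -> _})).
Qed.

Lemma trace_trans L M N (x : N) : gen L M -> trace M x -> trace L x.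
Proof.
move=> gLM tx; apply: (tx _ (trace_submodule L N)) => f m.
exact: (trace_map f (gLM m)).
Qed.

Lemma gen_refl M : gen M M.
Proof. move=> x; exact: (trace_im (idfun : {linear M -> M})). Qed.

Lemma gen_trans L M N : gen L M -> gen M N -> gen L N.
Proof. by move=> gLM gMN x; apply: trace_trans gLM (gMN x). Qed.

Lemma gen_quotient M N : quotient_of M N -> gen M N.
Proof. by move=> [f fS] y; have [x <-] := fS y; apply: trace_im. Qed.

Lemma gen_zero M N : zero_module N -> gen M N.
Proof. by move=> N0 x; rewrite (N0 x); case: (trace_submodule M N). Qed.

Lemma gen_prod M N L : gen M N -> gen M L -> gen M (N * L)%type.
Proof.
move=> gN gL [x y]; rewrite sum_proj.
exact: (submoduleD (trace_submodule M _) (trace_map (inlm N L) (gN x))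
  (trace_map (inrm N L) (gL y))).
Qed.

Lemma gen_eq0 M N : gen M N -> (forall f : {linear M -> N}, f =1 \0) ->
  zero_module N.
Proof.
by move=> gMN f0 x; apply: (gMN x _ (zero_submodule N)) => f m; apply: f0.
Qed.

Lemma fac_refl M : finitely_generated M -> fac M M.
Proof. by split=> //; apply: gen_refl. Qed.

Lemma fac_pretorsion M : pretorsion_class R (fac M).
Proof.
split.
- split=> [N []//|N L /quotient_of_iso qNL [fgN gMN]]; split.
    exact: fg_quotient fgN.
  exact: gen_trans gMN (gen_quotient qNL).
- by move=> N N0; split; [apply: fg_zero|apply: gen_zero].
- move=> N L qNL [fgN gMN]; split; first exact: fg_quotient fgN.
  exact: gen_trans gMN (gen_quotient qNL).
- by move=> N L [fgN gN] [fgL gL]; split; [apply: fg_prod|apply: gen_prod].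
Qed.

Lemma zero_pretorsion : pretorsion_class R (@zero_module R).
Proof.
split=> //.
- split=> [N|N L [f /bij_surj fS] N0 y]; first exact: fg_zero.
  by have [x <-] := fS y; rewrite (N0 x) linear0.
- by move=> N L [f fS] N0 y; have [x <-] := fS y; rewrite (N0 x) linear0.
- by move=> N L N0 L0 [x y]; rewrite (N0 x) (L0 y).
Qed.

Lemma zero_torsion : torsion_class R (@zero_module R).
Proof.
split; first exact: zero_pretorsion.
move=> L M N [f [g [_ exg _]]] L0 N0 x.
have [l <-] : exists l, f l = x by apply/exg; apply: N0.
by rewrite (L0 l) linear0.
Qed.

Lemma fac_min M (Y : subcat R) : pretorsion_class R Y -> Y M ->
  subcat_le (fac M) Y.
Proof.
move=> [_ _ Yq Yp] YM N [/finitely_generatedP[n [e eP]] gMN].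
(* The elements hit by maps from objects of [Y] form a submodule, because two such maps combine into
   one on the product. *)
have covered x : exists2 Z, Y Z & exists (h : {linear Z -> N}) z, h z = x.
  apply: (gMN x (fun x => exists2 Z, Y Z &
      exists (h : {linear Z -> N}) z, h z = x)) => [|f m].
    2: by exists M => //; exists f, m.
  split=> [|a _ _ [Z YZ [h [z <-]]] [W YW [g [w <-]]]].
    by exists M => //; exists (\0 : {linear M -> N}), 0.
  exists (Z * W)%type; first exact: Yp.
  by exists (copairm h g), (a *: z, w); rewrite /= linearZ.
(* One object must serve all generators at once; it is built by induction on their number, one
   factor per generator. *)
suff [Z YZ [h hZ]] : exists2 Z, Y Z &
    exists h : {linear Z -> N}, forall i, exists z, h z = e i.
  by apply: (Yq Z) => //; exists h; apply: (eP _ (im_submodule h)).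
elim: n e {eP} => [|n IHn] e.
  by exists M => //; exists (\0 : {linear M -> N}) => -[].
have [Z YZ [h hZ]] := IHn (fun i => e (lift ord0 i)).
have [W YW [g [w gw]]] := covered (e ord0).
exists (Z * W)%type; first exact: Yp.
exists (copairm h g) => i; case: (unliftP ord0 i) => [j ->|->].
  by have [z hz] := hZ j; exists (z, 0); rewrite /= linear0 addr0.
by exists (0, w); rewrite /= linear0 add0r.
Qed.

(** * Bricks *)

Lemma brick_idem M (f : {linear M -> M}) : brick M ->
  (forall x, f (f x) = f x) -> (forall x, f x = 0) \/ (forall x, f x = x).
Proof.
move=> [_ brM] ff; have [f0|f0] := EM (forall x, f x = 0); first by left.
by right=> x; have [g [fK _]] := brM f f0; apply: (can_inj fK).
Qed.

(** The projection onto one factor is an idempotent, hence 0 or 1 on a brick, and the corresponding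
    factor vanishes. *)
Lemma brick_indecomposable M : brick M -> indecomposable M.
Proof.
move=> brM; split=> [|N1 N2 [f [g fK gK]]]; first by case: brM.
have fbij : bijective f by exists g.
have fS := bij_surj fbij.
have [h [fh hf]] := linear_inverse (bij_inj fbij) fS.
pose e : {linear M -> M} :=
  h \o inlm N1 N2 \o (fst : {linear (N1 * N2)%type -> N1}) \o f.
have ee x : e (e x) = e x by rewrite /= hf.
case: (brick_idem brM ee) => ex; [left=> a|right=> b].
  have := ex (h (a, 0)); rewrite /= hf /= => /(congr1 f).
  by rewrite hf linear0 => -[].
have := ex (h (0, b)); rewrite /= hf /= => /(congr1 f).
by rewrite !hf => -[].
Qed.

Lemma brick_iso M N : isomorphic M N -> brick M -> brick N.
Proof.
move=> [f fbij] [M0 brM].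
have [h [fh hf]] := linear_inverse (bij_inj fbij) (bij_surj fbij).
split=> [N0|u u0].
  by apply: M0 => x; apply: (bij_inj fbij); rewrite (N0 (f x)) linear0.
have [|v [uK vK]] := brM (h \o u \o f : {linear M -> M}).
  move=> hu0; apply: u0 => y; have := hu0 (h y); rewrite /= hf => hu.
  by rewrite -(hf (u y)) hu linear0.
exists (f \o v \o h : {linear N -> N}); split=> y /=.
  by have := uK (h y); rewrite /= hf => ->; rewrite hf.
by have := vK (h y); rewrite /= => /(congr1 f); rewrite !hf.
Qed.

End Generation.

(** * Finite-dimensional algebras *)

Section Dimension.
Variables (k : fieldType) (A : falgType k).
Implicit Types B E L M N : rmodType A.

(** The module carries only an action of [A^c]; the vector space structure is recovered through the
    multiples of 1. *)
Definition kscale M (c : k) (x : M) : M := (c%:A : A^c) *: x.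

Lemma kscaleDl M (x : M) c d : kscale (c + d) x = kscale c x + kscale d x.
Proof. by rewrite /kscale -scalerDl; congr (_ *: x); apply: scalerDl. Qed.

Lemma kscaleDr M c (x y : M) : kscale c (x + y) = kscale c x + kscale c y.
Proof. exact: scalerDr. Qed.

Lemma kscaleA M c d (x : M) : kscale c (kscale d x) = kscale (c * d) x.
Proof.
rewrite /kscale scalerA; congr (_ *: x).
by rewrite [LHS]/GRing.mul /= -scalerAl mul1r scalerA mulrC.
Qed.

Lemma kscale1 M (x : M) : kscale 1 x = x.
Proof. by rewrite /kscale scale1r; apply: scale1r. Qed.

Lemma kscale0 M (x : M) : kscale 0 x = 0.
Proof. by rewrite /kscale scale0r; apply: scale0r. Qed.

Lemma kscaleN M c (x : M) : kscale (- c) x = - kscale c x.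
Proof. by rewrite /kscale scaleNr; apply: scaleNr. Qed.

Lemma kscaleNr M c (x : M) : kscale c (- x) = - kscale c x.
Proof. exact: scalerN. Qed.

Lemma kscale_sum M c I (r : seq I) P (F : I -> M) :
  kscale c (\sum_(i <- r | P i) F i) = \sum_(i <- r | P i) kscale c (F i).
Proof. exact: scaler_sumr. Qed.

Lemma kscale_suml M (x : M) I (r : seq I) P (F : I -> k) :
  kscale (\sum_(i <- r | P i) F i) x = \sum_(i <- r | P i) kscale (F i) x.
Proof.
apply: (big_morph (fun c => kscale c x)) => [c d|]; first exact: kscaleDl.
exact: kscale0.
Qed.

(** Multiples of 1 are central. Hence an additive subgroup stable under all endomorphisms is a
    [k]-subspace. *)
Lemma kscale_linear M c : linear (@kscale M c).
Proof.
move=> a x y; rewrite kscaleDr /kscale !scalerA; congr (_ *: x + _).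
by rewrite /GRing.mul /= -scalerAl mul1r -scalerAr mulr1.
Qed.

Lemma linear_kscale M N (f : {linear M -> N}) c x :
  f (kscale c x) = kscale c (f x).
Proof. exact: linearZ. Qed.

Definition kspan M (I : finType) (e : I -> M) : Prop :=
  forall x, exists c : I -> k, x = \sum_i kscale (c i) (e i).

Definition kdim_le M n : Prop := exists e : 'I_n -> M, kspan e.

Lemma kspan_card M (I : finType) (e : I -> M) : kspan e -> kdim_le M #|I|.
Proof.
move=> eP; exists (e \o enum_val) => x; have [c ->] := eP x.
exists (c \o enum_val); rewrite (reindex_omap enum_val (some \o enum_rank)) /=.
  by apply: eq_bigl => i; rewrite enum_valK eqxx.
by move=> i _; rewrite enum_rankK.
Qed.

Lemma fg_kdim M : finitely_generated M -> exists n, kdim_le M n.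
Proof.
move=> [n [e eP]]; pose b := vbasis {:A}.
exists #|{: 'I_n * 'I_(\dim {:A})}|.
apply: (@kspan_card M ('I_n * 'I_(\dim {:A}))%type
  (fun p => (b`_p.2 : A^c) *: e p.1)) => x.
have [c ->] := eP x; exists (fun p => coord b p.2 (c p.1)).
rewrite -(pair_bigA _
  (fun i j => kscale (coord b j (c i)) ((b`_j : A^c) *: e i))).
apply: eq_bigr => i _; rewrite {1}(coord_vbasis (memvf (c i : A))).
rewrite [LHS]scaler_suml; apply: eq_bigr => j _.
rewrite /kscale scalerA; congr (_ *: e i).
by rewrite [RHS]/GRing.mul /= -scalerAr mulr1.
Qed.

(** * Proper quotients and descent on dimension *)

Definition proper_quotient M N : Prop :=
  exists2 f : {linear M -> N}, surj f & ~ injective f.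

Lemma kdim_drop M N n (f : {linear M -> N}) (e : 'I_n.+1 -> M)
    (c : 'I_n.+1 -> k) i :
  surj f -> kspan e -> \sum_j kscale (c j) (f (e j)) = 0 -> c i != 0 ->
  kdim_le N n.
Proof.
move=> fS eP ce0 ci.
pose t : 'I_n -> k := fun j => - (c i)^-1 * c (lift i j).
have fei : f (e i) = \sum_j kscale (t j) (f (e (lift i j))).
  move: ce0; rewrite (bigD1_ord i) //= => /eqP; rewrite addr_eq0 => /eqP.
  move=> /(congr1 (kscale (c i)^-1)); rewrite kscaleA mulVf // kscale1 => ->.
  rewrite kscaleNr kscale_sum -sumrN; apply: eq_bigr => j _.
  by rewrite kscaleA -kscaleN /t mulNr.
exists (fun j => f (e (lift i j))) => y; have [z <-] := fS y.
have [d ->] := eP z; exists (fun j => d i * t j + d (lift i j)).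
rewrite linear_sum (bigD1_ord i) //= linear_kscale fei kscale_sum -big_split /=.
by apply: eq_bigr => j _; rewrite linear_kscale kscaleDl kscaleA.
Qed.

Lemma proper_quotient_kdim M N n : proper_quotient M N -> kdim_le M n ->
  exists2 m, (m < n)%N & kdim_le N m.
Proof.
move=> [f fS /not_inj_ker[x fx0 x0]] [e eP]; have [c xE] := eP x.
case: n e eP c xE => [|n] e eP c xE; first by case: x0; rewrite xE big_ord0.
have [i ci] : exists i, c i != 0.
  apply: contrapT => c0; apply: x0; rewrite xE big1 // => i _.
  suff /eqP->: c i == 0 by rewrite kscale0.
  by apply/negPn/negP => ci; apply: c0; exists i.
exists n => //; apply: (kdim_drop (f := f) (c := c) fS eP) ci.
rewrite -[RHS]fx0 xE linear_sum; apply: eq_bigr => j _.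
by rewrite linear_kscale.
Qed.

(** The size of a spanning family strictly decreases along proper quotients, so the recursion is
    well founded. *)
Lemma proper_quotient_ind (P : subcat A) :
  (forall M, finitely_generated M ->
    (forall N, proper_quotient M N -> P N) -> P M) ->
  forall M, finitely_generated M -> P M.
Proof.
move=> IH M fgM; have [n] := fg_kdim fgM.
elim/ltn_ind: n M fgM => n IHn M fgM Mn; apply: IH => // N MN.
have [m mn Nm] := proper_quotient_kdim MN Mn.
by apply: (IHn m) => //; case: MN => f fS _; apply: fg_quotient fgM; exists f.
Qed.

(** Infinite descent: otherwise [M] is a proper quotient of itself, and its dimension bound drops
    forever. *)
Lemma surj_inj M (f : {linear M -> M}) :
  finitely_generated M -> surj f -> injective f.
Proof.
move=> fgM fS; apply: contrapT => fI; have [n] := fg_kdim fgM.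
elim/ltn_ind: n => n IHn /(@proper_quotient_kdim M M)[|m mn /IHn]; last exact.
by exists f.
Qed.

Lemma kbasis_exists M : finitely_generated M ->
  exists n (e : 'I_n -> M), kspan e /\
    forall c : 'I_n -> k, \sum_i kscale (c i) (e i) = 0 -> forall i, c i = 0.
Proof.
move=> fgM; have [n] := fg_kdim fgM; elim/ltn_ind: n => n IHn [e eP].
have [free|] := EM (forall c : 'I_n -> k,
  \sum_i kscale (c i) (e i) = 0 -> forall i, c i = 0); first by exists n, e.
move=> /existsNP[c /not_implyP[ce0 /existsNP[i /eqP ci]]].
case: n IHn e eP c ce0 i ci => [|n] IHn e eP c ce0 i ci; first by case: i ci.
apply: (IHn n) => //.
apply: (kdim_drop (f := (idfun : {linear M -> M})) _ eP ce0 ci).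
by move=> y; exists y.
Qed.

(** In a [k]-basis, the matrix of an injective endomorphism has trivial left kernel, hence is
    invertible. *)
Lemma inj_surj M (f : {linear M -> M}) :
  finitely_generated M -> injective f -> surj f.
Proof.
move=> /kbasis_exists[n [e [eP free]]] fI.
have [F fe] := choice (fun i => eP (f (e i))).
pose Fm := \matrix_(i, j) F i j.
have fE (c : 'rV_n) : f (\sum_i kscale (c 0 i) (e i)) =
    \sum_j kscale ((c *m Fm) 0 j) (e j).
  rewrite linear_sum /=.
  under eq_bigr => i _ do rewrite linear_kscale fe kscale_sum.
  rewrite exchange_big; apply: eq_bigr => j _; rewrite mxE kscale_suml.
  by apply: eq_bigr => i _; rewrite kscaleA mxE.
have Fu : Fm \in unitmx.
  rewrite -row_free_unit; apply/inj_row_free => c cF.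
  have /(inj_ker0 fI)/free c0 : f (\sum_i kscale (c 0 i) (e i)) = 0.
    by rewrite fE big1 // => j _; rewrite cF mxE kscale0.
  by apply/rowP => i; rewrite c0 mxE.
move=> y; have [c ->] := eP y; pose d := \row_i c i *m invmx Fm.
exists (\sum_i kscale (d 0 i) (e i)); rewrite fE mulmxKV //.
by apply: eq_bigr => i _; rewrite mxE.
Qed.

(** * Endomorphisms of indecomposable modules *)

Lemma iter_linear M (f : {linear M -> M}) n : linear (iter n f).
Proof. by move=> a x y; elim: n => //= n ->; rewrite linearP. Qed.

(** Induction on [M / ker f]: for the induced map [f'], the kernel of its [n]-th iterate pulls back
    to that of [iter n.+1 f], so one extra step is added. *)
Lemma iter_ker_stable M : finitely_generated M -> forall f : {linear M -> M},
  exists n, forall x, iter n.+1 f x = 0 -> iter n f x = 0.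
Proof.
move: M; apply: proper_quotient_ind => M fgM IH f.
have [fI|fNI] := EM (injective f); first by exists 0%N => x /(inj_ker0 fI).
have [Q [p [pS pE]]] := quotient_exists (ker_submodule f).
have [|f' f'E] := factor_through (h := p \o f : {linear M -> Q}) pS.
  by move=> x /pE /= ->; rewrite linear0.
have [|n stab] := IH Q _ f'.
  exists p => // pI; apply: fNI; apply: ker0_inj => x /pE px.
  exact: (inj_ker0 pI).
have itE m x : iter m f' (p x) = p (iter m f x).
  by elim: m => //= m ->; rewrite f'E.
exists n.+1 => x /= /pE; rewrite -[f (iter n f x)]/(iter n.+1 f x) -itE.
by move=> /stab; rewrite itE => /pE.
Qed.

(* If ker f^n is stable then M = ker f^n + im f^n is a direct sum, phrased here
   as M = M/ker f^n x M/im f^n. *)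
Lemma fitting M (f : {linear M -> M}) : finitely_generated M ->
  indecomposable M -> injective f \/ exists n, forall x, iter n f x = 0.
Proof.
move=> fgM [_ indM]; have [n stab] := iter_ker_stable fgM f.
pose g := linear_pack (@iter_linear M f n).
have gg x : g (g x) = 0 -> g x = 0.
  rewrite /= -iterD; have: (n <= n + n)%N by rewrite leq_addr.
  move: (n + n)%N => m; elim: m => [|m IHm]; first by rewrite leqn0 => /eqP->.
  rewrite leq_eqVlt ltnS => /predU1P[<-//|nm]; rewrite -(subnKC nm) -addnS.
  rewrite addnS iterS iterD -iterS => /stab; rewrite -iterD subnKC //.
  exact: IHm.
have [Q1 [p1 [p1S p1E]]] := quotient_exists (ker_submodule g).
have [Q2 [p2 [p2S p2E]]] := quotient_exists (im_submodule g).
have [|g' g'E] := factor_through (h := p1 \o g : {linear M -> Q1}) p1S.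
  by move=> x /p1E /= ->; rewrite linear0.
have g'I : injective g'.
  apply: ker0_inj => q; have [x <-] := p1S q.
  by rewrite g'E /= => /p1E/gg/p1E.
have fgQ1 : finitely_generated Q1 by apply: fg_quotient fgM; exists p1.
(* Since [g'] is injective on the finite-dimensional [M / ker g], it is onto, which gives
   [M = im g + ker g]. *)
have split_M x : exists y, g (x - g y) = 0.
  have [q q'E] := inj_surj fgQ1 g'I (p1 x); have [y yq] := p1S q.
  by exists y; apply/p1E; rewrite linearB -q'E -yq g'E subrr.
have bij_p : bijective (pairm p1 p2).
  apply: inj_surj_bij.
    by apply: ker0_inj => x [/p1E gx /p2E[z zx]]; rewrite -zx gg // zx.
  move=> [q1 q2]; have [u <-] := p1S q1; have [v <-] := p2S q2.
  have [[y gy] [z gz]] := (split_M u, split_M v).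
  exists (g y + (v - g z)); congr (_, _); apply/subr0_eq; rewrite -linearB.
    by apply/p1E; rewrite addrAC linearD gz addr0 -opprB linearN gy oppr0.
  by apply/p2E; exists (y - z); rewrite addrA addrAC addrK linearB.
have [|Q10|Q20] := indM Q1 Q2; first by exists (pairm p1 p2).
  by right; exists n => x; apply/p1E/Q10.
left; apply: ker0_inj => x fx0; have [z zx] : exists z, g z = x.
  exact/p2E/Q20.
by move: fx0; rewrite -zx => /stab.
Qed.

(** With [v] the inverse of the sum, [v \o f] is injective or nilpotent by Fitting. On [ker g] it is
    the identity, so nilpotency forces [ker g] to vanish. *)
Lemma indecomposable_local M (f g : {linear M -> M}) :
  finitely_generated M -> indecomposable M -> injective (f \+ g) ->
  injective f \/ injective g.
Proof.
move=> fgM indM fgI.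
have [v [vK _]] :=
  linear_inverse fgI (inj_surj (f := f \+ g : {linear M -> M}) fgM fgI).
have [vfI|[n vfn]] := fitting (v \o f : {linear M -> M}) fgM indM.
  by left=> x y fxy; apply: vfI; rewrite /= fxy.
right; apply: ker0_inj => x gx0.
have vfx : v (f x) = x by rewrite -[RHS]vK /= gx0 addr0.
by rewrite -(vfn x); elim: n {vfn} => //= n <-; rewrite vfx.
Qed.

(* Nakayama's lemma for the local ring End(M) and its radical, which consists
   of the non-injective endomorphisms. *)
Lemma noninjective_images_proper M : finitely_generated M -> indecomposable M ->
  ~ (forall x (P : M -> Prop), P 0 -> (forall y z, P y -> P z -> P (y + z)) ->
       (forall (h : {linear M -> M}) y, ~ injective h -> P (h y)) -> P x).
Proof.
move=> fgM indM radM; have [M0 _] := indM.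
have zero_not_inj : ~ injective (\0 : {linear M -> M}).
  by move=> I0; apply: M0 => x; apply: I0.
pose stable (N : M -> Prop) := [/\ N 0, forall y z, N y -> N z -> N (y + z)
  & forall (h : {linear M -> M}) y, N y -> N (h y)].
(* Nakayama: a stable [N] which generates [M] together with [n] elements is all of [M]. The
   generators are eliminated one at a time. *)
have main n (e : 'I_n -> M) (N : M -> Prop) : stable N ->
    (forall P : M -> Prop, stable P -> (forall x, N x -> P x) ->
      (forall i, P (e i)) -> forall x, P x) ->
    forall x, N x.
  elim: n e N => [|n IHn] e N sN eP; first by apply: eP => // -[].
  have [N0 ND NE] := sN; set e0 := e ord0.
  have N'T : forall x, exists2 y, N y &
      exists h : {linear M -> M}, x = y + h e0.
    apply: (IHn (fun i => e (lift ord0 i)) (fun x => exists2 y, N y &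
      exists h : {linear M -> M}, x = y + h e0)) => [|P sP N'P Pe].
      split.
      - by exists 0 => //; exists (\0 : {linear M -> M}); rewrite add0r.
      - move=> _ _ [y Ny [h ->]] [z Nz [g ->]]; exists (y + z); first exact: ND.
        by exists (h \+ g : {linear M -> M}); rewrite addrACA.
      - move=> g _ [y Ny [h ->]]; exists (g y); first exact: NE.
        by exists (g \o h : {linear M -> M}); rewrite linearD.
    apply: eP => // [x Nx|i].
      apply: N'P; exists x => //; exists (\0 : {linear M -> M}).
      by rewrite addr0.
    case: (unliftP ord0 i) => [j ->|->]; first exact: Pe.
    apply: N'P; exists 0 => //; exists (idfun : {linear M -> M}).
    by rewrite add0r.
  (* As [M] is spanned by images of non-injective maps, [e0] is [j e0] modulo [N]; a composite
     [h \o g] with [h] non-injective stays non-injective. *)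
  have [y Ny [j jNI e0E]] : exists2 y, N y &
      exists2 j : {linear M -> M}, ~ injective j & e0 = y + j e0.
    apply: (radM e0 (fun x => exists2 y, N y &
      exists2 j : {linear M -> M}, ~ injective j & x = y + j e0)).
    - by exists 0 => //; exists (\0 : {linear M -> M}); rewrite ?add0r.
    - move=> _ _ [y Ny [h hNI ->]] [z Nz [g gNI ->]].
      exists (y + z); first exact: ND.
      exists (h \+ g : {linear M -> M}); last by rewrite addrACA.
      by move=> /(indecomposable_local fgM indM)[].
    - move=> h x hNI; have [y Ny [g ->]] := N'T x.
      exists (h y); first exact: NE.
      exists (h \o g : {linear M -> M}); last by rewrite linearD.
      move=> hgI; apply/hNI/surj_inj => // z.
      have [w <-] := inj_surj (f := h \o g : {linear M -> M}) fgM hgI z.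
      by exists (g w).
  (* By locality [1 - j] is invertible, so [e0] is the image of [y] under its inverse and lies in
     the stable [N]. *)
  have e0N : N e0.
    have uI : injective ((idfun : {linear M -> M}) \- j).
      have [|/jNI|] // := @indecomposable_local M j (idfun \- j) fgM indM.
      by move=> x z /=; rewrite (addrC (j x)) (addrC (j z)) !subrK.
    have [u [uK _]] := linear_inverse uI
      (inj_surj (f := idfun \- j : {linear M -> M}) fgM uI).
    suff <- : u y = e0 by apply: NE.
    by rewrite -[RHS]uK /= {1}e0E addrK.
  by move=> x; have [z Nz [h ->]] := N'T x; apply: ND => //; apply: NE.
have [n [e eP]] := fg_kdim fgM.
apply: M0; apply: (main n e (fun x => x = 0)) => [|P [P0 PD PE] _ Pe x].
  split=> // [y z -> ->|h y ->]; [exact: addr0|by rewrite linear0].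
have [c ->] := eP x; elim/big_ind: _ => // i _.
exact: (PE (linear_pack (@kscale_linear M (c i)))).
Qed.

(** Elements of [M] are sums of images of composites [M -> N -> M]. Were all these non-injective,
    they would exhaust [M], against the preceding lemma. *)
Lemma gen_antisym_split M N : finitely_generated M -> indecomposable M ->
  gen M N -> gen N M ->
  exists (b : {linear M -> N}) (a : {linear N -> M}), injective (a \o b).
Proof.
move=> fgM indM gMN gNM; apply: contrapT => noinj.
apply: (noninjective_images_proper fgM indM) => x P P0 PD PJ.
pose rad (x : M) := forall P : M -> Prop, P 0 ->
  (forall y z, P y -> P z -> P (y + z)) ->
  (forall (h : {linear M -> M}) y, ~ injective h -> P (h y)) -> P x.
have sub_rad : is_submodule rad.
  split=> [//|a y z Qy Qz S S0 SD SJ]; apply: (SD _ _ _ (Qz S S0 SD SJ)).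
  apply: (Qy (fun y => S (a *: y))) => [|u v Su Sv|h u hNI].
  - by rewrite scaler0.
  - by rewrite scalerDr; apply: SD.
  - by rewrite -linearZ; apply: SJ.
suff: rad x by apply.
apply: (gNM x _ sub_rad) => a n.
apply: (gMN n _ (preimage_submodule a sub_rad)) => b m S _ _ SJ.
by apply: (SJ (a \o b : {linear M -> M})) => abI; apply: noinj; exists b, a.
Qed.

(** * Completely join-irreducible classes *)

Lemma gen_of_injective_comp M N (b : {linear M -> N}) (a : {linear N -> M}) :
  finitely_generated M -> injective (a \o b) -> gen N M.
Proof.
move=> fgM abI; apply: gen_quotient; exists a => y.
have [x <-] := inj_surj (f := a \o b : {linear M -> M}) fgM abI y.
by exists (b x).
Qed.

Lemma gen_antisym_iso M N : finitely_generated M -> indecomposable M ->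
  finitely_generated N -> indecomposable N ->
  gen M N -> gen N M -> isomorphic M N.
Proof.
move=> fgM indM fgN indN gMN gNM; have [M0 _] := indM.
have [b [a abI]] := gen_antisym_split fgM indM gMN gNM.
have abS := inj_surj (f := a \o b : {linear M -> M}) fgM abI.
have [u [uK Ku]] := linear_inverse abI abS.
(* The idempotent onto the image of the split monomorphism [b]. Locality of [End(N)] leaves two
   cases: [e] injective makes [b] onto, while [1 - e] injective forces [b = 0]. *)
pose e : {linear N -> N} := b \o u \o a.
have eD : injective (e \+ ((idfun : {linear N -> N}) \- e)).
  by move=> x y /=; rewrite ![b (u (a _)) + _]addrC !subrK.
have [|eI|eI] := indecomposable_local (f := e) (g := idfun \- e) fgN indN.
- exact: eD.
- exists b; apply: inj_surj_bij => [x y bxy|y].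
    by apply: abI; rewrite /= bxy.
  have [x <-] := inj_surj fgN eI y; by exists (u (a x)).
- case: M0 => x; apply: abI; rewrite /= (_ : b x = 0) ?linear0 //.
  by apply: (inj_ker0 eI); rewrite /= [u _]uK subrr.
Qed.

(* The largest pretorsion class properly contained in [fac M], for M
   indecomposable. *)
Definition fac0 M : subcat A := fun N => fac M N /\ ~ gen N M.

(** Only sums need an argument: if [N * L] generates [M], an injective composite through [N * L] is
    the sum of those through [N] and [L]. By locality one of these is injective, so [N] or [L]
    generates [M]. *)
Lemma fac0_pretorsion M : finitely_generated M -> indecomposable M ->
  pretorsion_class A (fac0 M).
Proof.
move=> fgM indM; have [M0 _] := indM.
have [[Ffg Fiso] Fz Fq Fp] := fac_pretorsion M.
have quot N L : quotient_of N L -> fac0 M N -> fac0 M L.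
  move=> qNL [FN NgN]; split; first exact: Fq FN.
  by move=> gLM; apply: NgN; apply: gen_trans (gen_quotient qNL) gLM.
split=> //.
- split=> [N [/Ffg]//|N L /quotient_of_iso]; exact: quot.
- move=> N N0; split; first exact: Fz.
  by move=> gNM; apply: M0; apply: gen_eq0 gNM _ => f x; rewrite (N0 x) linear0.
- move=> N L [FN NgN] [FL NgL]; split; first exact: Fp.
  move=> gM; have [b [a abI]] := gen_antisym_split fgM indM (Fp _ _ FN FL).2 gM.
  pose b1 : {linear M -> N} := (fst : {linear (N * L)%type -> N}) \o b.
  pose b2 : {linear M -> L} := (snd : {linear (N * L)%type -> L}) \o b.
  have [x y||] := indecomposable_local (f := (a \o inlm N L) \o b1)
    (g := (a \o inrm N L) \o b2) fgM indM.
  - rewrite /= -!linearD -!sum_proj -!surjective_pairing; exact: abI.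
  - by move=> /(gen_of_injective_comp fgM).
  - by move=> /(gen_of_injective_comp fgM).
Qed.

(** Stated for a family [C] so as to serve both lattices; the lower cover is [fac0 M]. A class of
    [C] containing a module that generates [M] contains [fac M] by minimality. *)
Lemma fac_cji (C : subcat A -> Prop) M :
  (forall Y, C Y -> pretorsion_class A Y) -> finitely_generated M ->
  ~ zero_module M -> C (fac M) -> C (@zero_module A) -> C (fac0 M) ->
  completely_join_irreducible C (fac M).
Proof.
move=> Cpre fgM M0 CF C0 CF0; split=> //.
  by move=> /(_ _ C0)/(_ M (fac_refl fgM)).
exists (fac0 M); split=> // [eqF|Y CY].
  have [_ ngM] : fac0 M M by apply/eqF/fac_refl.
  by apply: ngM; apply: gen_refl.
split=> [[leY neY] N YN|leY].
  split=> [|gNM]; first exact: leY.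
  apply: neY => L; split=> [|FL]; first exact: leY.
  apply: (fac_min (Cpre _ CY) _ FL); apply: (fac_min (Cpre _ CY) YN).
  by split.
split=> [N /leY[]//|eqY].
have [_ ngM] : fac0 M M by apply/leY/eqY/fac_refl.
by apply: ngM; apply: gen_refl.
Qed.

(** If [E] generates [M] through [a], then [a] kills [L]: a nonzero composite [M -> L -> M] would be
    invertible on the brick and make [L] generate [M]. So [a] factors through [N], which then
    generates [M]. *)
Lemma fac0_torsion M : finitely_generated M -> brick M ->
  torsion_class A (fac M) -> torsion_class A (fac0 M).
Proof.
move=> fgM brM [_ torM]; have indM := brick_indecomposable brM.
split=> [|L E N extE [FL ngL] [FN ngN]]; first exact: fac0_pretorsion.
have FE := torM _ _ _ extE FL FN; split=> // gEM.
have [i [p [_ exE pS]]] := extE.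
have [b [a abI]] := gen_antisym_split fgM indM FE.2 gEM.
have ai0 x : a (i x) = 0.
  apply: (FL.2 x _ (ker_submodule (a \o i : {linear L -> M}))) => c m.
  apply: contrapT => aicm; apply: ngL.
  have [h [aicK _]] : exists h : {linear M -> M},
      cancel (a \o i \o c) h /\ cancel h (a \o i \o c).
    apply: (brM.2 (a \o i \o c : {linear M -> M})) => aic0.
    by apply: aicm; apply: aic0.
  exact: (@gen_of_injective_comp M L c (a \o i)) fgM (can_inj aicK).
have [|a' a'E] := factor_through (h := a) pS.
  by move=> _ /exE[x <-]; apply: ai0.
apply: ngN; apply: (@gen_of_injective_comp M N (p \o b) a' fgM) => x y.
by rewrite /= !a'E; apply: abI.
Qed.

Lemma not_indecomposable M : ~ zero_module M -> ~ indecomposable M ->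
  exists N1 N2 : rmodType A,
    [/\ isomorphic M (N1 * N2)%type, ~ zero_module N1 & ~ zero_module N2].
Proof.
move=> M0 indM; apply: contrapT => H; apply: indM; split=> // N1 N2 isoN.
have [N10|N10] := EM (zero_module N1); first by left.
by right; apply: contrapT => N20; apply: H; exists N1, N2.
Qed.

(** If [M] decomposes, some factor lies outside [T], as [T] is closed under sums; that factor is a
    proper quotient, so induction applies. *)
Lemma indecomposable_summand (T : subcat A) M : pretorsion_class A T ->
  finitely_generated M -> ~ T M ->
  exists N,
    [/\ finitely_generated N, quotient_of M N, indecomposable N & ~ T N].
Proof.
move=> [[_ Tiso] Tz Tq Tp]; move: M.
apply: proper_quotient_ind => M fgM IH TM.
have [indM|indM] := EM (indecomposable M).
  by exists M; split=> //; exists (idfun : {linear M -> M}) => y; exists y.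
have [|N1 [N2 [isoM N10 N20]]] := not_indecomposable _ indM.
  by move=> M0; apply: TM; apply: Tz.
have [f fbij] := isoM; have fS := bij_surj fbij.
have [g [fg gf]] := linear_inverse (bij_inj fbij) fS.
have step N (p : {linear M -> N}) : surj p -> ~ injective p -> ~ T N ->
    exists N', [/\ finitely_generated N', quotient_of M N', indecomposable N'
      & ~ T N'].
  move=> pS pNI TN; have [|N' [fgN' [q qS] indN' TN']] := IH N _ TN.
    by exists p.
  exists N'; split=> //; exists (q \o p : {linear M -> N'}) => y.
  by have [z <-] := qS y; have [x <-] := pS z; exists x.
have [TN1|TN1] := EM (T N1); last first.
  apply: (step N1 ((fst : {linear (N1 * N2)%type -> N1}) \o f)) TN1.
    by move=> y; exists (g (y, 0)); rewrite /= gf.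
  move=> fI; apply: N20 => y; have /fI/(congr1 f) : (f (g (0, y))).1 = (f 0).1.
    by rewrite gf linear0.
  by rewrite gf linear0 => -[].
have [TN2|TN2] := EM (T N2); last first.
  apply: (step N2 ((snd : {linear (N1 * N2)%type -> N2}) \o f)) TN2.
    by move=> y; exists (g (0, y)); rewrite /= gf.
  move=> fI; apply: N10 => x; have /fI/(congr1 f) : (f (g (x, 0))).2 = (f 0).2.
    by rewrite gf linear0.
  by rewrite gf linear0 => -[].
case: TM; apply: (Tiso (N1 * N2)%type); last exact: Tp.
by exists g; exists f.
Qed.

(** * Extensions by bricks and the torsion classes Fac B *)

(* Ext^1(B, Fac B) = 0. In a nonsplit extension E of B by L in Fac B, L is the
   trace of B in E. If E is indecomposable, E -> B -> L -> E is a nonzero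
   singular endomorphism. Otherwise the idempotents of E preserve the trace,
   hence act on the brick B as 0 or 1, and one summand is again nonsplit. *)
Lemma brick_surj_split B E : @locally_representation_directed A -> brick B ->
  finitely_generated E -> forall p : {linear E -> B}, surj p ->
  (forall x, p x = 0 -> trace B x) ->
  exists s : {linear B -> E}, cancel s p.
Proof.
move=> lrd brB; have [B0 divB] := brB; move: E.
apply: proper_quotient_ind => E fgE IH p pS kerp; apply: contrapT => nsplit.
(* A nonzero [p \o f] is invertible on the brick and yields a section. Hence [ker p] is exactly the
   trace of [B]. *)
have maps0 (f : {linear B -> E}) b : p (f b) = 0.
  apply: contrapT => pfb; apply: nsplit.
  have [|h [pfK hK]] := divB (p \o f : {linear B -> B}).
    by move=> pf0; apply: pfb; apply: pf0.
  by exists (f \o h : {linear B -> E}) => x; apply: hK.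
have trace0 x : trace B x -> p x = 0.
  by move=> /(_ _ (ker_submodule p)); apply.
have E0 : ~ zero_module E.
  by move=> E0; apply: B0 => b; have [x <-] := pS b; rewrite (E0 x) linear0.
have [indE|indE] := EM (indecomposable E).
  have [pI|/not_inj_ker[x px x0]] := EM (injective p).
    by have [s [_ sK]] := linear_inverse pI pS; apply: nsplit; exists s.
  have [f [b fb]] : exists (f : {linear B -> E}) b, f b <> 0.
    apply: contrapT => H; apply: x0.
    apply: (kerp x px _ (zero_submodule E)) => f b.
    by apply: contrapT => fb; apply: H; exists f, b.
  have [_ divE] := lrd E fgE indE.
  have [|h [fpK _]] := divE (f \o p : {linear E -> E}).
    by move=> fp0; apply: fb; have [y <-] := pS b; apply: fp0.
  by apply: x0; rewrite -(fpK x) /= px !linear0.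
have [N1 [N2 [[f fbij] N10 N20]]] := not_indecomposable E0 indE.
have [g [fg gf]] := linear_inverse (bij_inj fbij) (bij_surj fbij).
have step N (i : {linear N -> E}) (q : {linear E -> N}) : cancel i q ->
    ~ injective q -> surj (p \o i) -> False.
  move=> iK qNI piS; have [|y /kerp ty|s sK] := IH N _ (p \o i) piS.
  - by exists q => // y; exists (i y); rewrite iK.
  - by rewrite -[y]iK; apply: trace_map.
  - by apply: nsplit; exists (i \o s : {linear B -> E}) => x; apply: sK.
pose i1 : {linear N1 -> E} := g \o inlm N1 N2.
pose i2 : {linear N2 -> E} := g \o inrm N1 N2.
pose q1 : {linear E -> N1} := (fst : {linear (N1 * N2)%type -> N1}) \o f.
pose q2 : {linear E -> N2} := (snd : {linear (N1 * N2)%type -> N2}) \o f.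
have iq x : x = i1 (q1 x) + i2 (q2 x).
  by rewrite /= -linearD -sum_proj -surjective_pairing fg.
have i1K : cancel i1 q1 by move=> x; rewrite /= gf.
have i2K : cancel i2 q2 by move=> x; rewrite /= gf.
have q2i1 x : q2 (i1 x) = 0 by rewrite /= gf.
have q1i2 x : q1 (i2 x) = 0 by rewrite /= gf.
(* The projection [i1 \o q1] preserves the trace, which is [ker p], and so induces an idempotent [e]
   of [B]. If [e = 0] then [p] stays onto on [N2]; if [e = 1], on [N1]. *)
have [|e eE] := factor_through (h := p \o i1 \o q1 : {linear E -> B}) pS.
  move=> x /kerp tx; apply/trace0.
  exact: (trace_map (i1 \o q1 : {linear E -> E}) tx).
have ee b : e (e b) = e b.
  have [x <-] := pS b.
  by rewrite eE [LHS]eE /= -[g _]/(i1 _) -[(f _).1]/(q1 _) i1K.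
case: (brick_idem brB ee) => eb.
  apply: (step N2 i2 q2 i2K) => [q2I|b].
    by apply: N10 => x; rewrite -[x]i1K (inj_ker0 q2I (q2i1 x)) linear0.
  have [x <-] := pS b; exists (q2 x); rewrite {2}(iq x) linearD.
  by rewrite -[p (i1 (q1 x))]eE eb add0r.
apply: (step N1 i1 q1 i1K) => [q1I|b].
  by apply: N20 => x; rewrite -[x]i2K (inj_ker0 q1I (q1i2 x)) linear0.
by have [x <-] := pS b; exists (q1 x); rewrite -[RHS]eb eE.
Qed.

(** The pullback of the extension along a map [B -> N] splits, so that map lifts to [E]. Hence the
    trace of [B] in [E] maps onto [N], and it also contains the image of [L]. *)
Lemma fac_torsion B : @locally_representation_directed A ->
  finitely_generated B -> brick B -> torsion_class A (fac B).
Proof.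
move=> lrd fgB brB; split=> [|L E N extE [fgL gL] [fgN gN]].
  exact: fac_pretorsion.
split=> [|y]; first exact: fg_extension extE fgL fgN.
have [i [p [iI exE pS]]] := extE.
have lift (f : {linear B -> N}) :
    exists h : {linear B -> E}, forall b, p (h b) = f b.
  (* The pullback of [p] along [f]. *)
  pose d : {linear (E * B)%type -> N} := copairm p (\0 \- f).
  have [P [j [jI jE]]] := submodule_exists (ker_submodule d).
  have jd u : p (j u).1 = f (j u).2.
    apply/subr0_eq; have /= := (jE (j u)).2 (ex_intro _ u erefl).
    by rewrite sub0r.
  pose q : {linear P -> B} := (snd : {linear (E * B)%type -> B}) \o j.
  have qS : surj q.
    move=> b; have [x px] := pS (f b).
    have [u ju] : exists u, j u = (x, b) by apply/jE; rewrite /= px sub0r subrr.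
    by exists u; rewrite /= ju.
  have /choice[l lE] (x : L) : exists u : P, j u = (i x, 0).
    apply/jE; rewrite /= linear0 subr0 addr0.
    by apply/exE; exists x.
  have l_lin : linear l.
    by move=> a x z; apply: jI; rewrite linearP !lE linearP -inl_linear.
  pose lm := linear_pack l_lin.
  have lI : injective lm.
    by move=> x z lxz; have := lE x; rewrite [l x]lxz lE => -[/iI].
  have lex u : q u = 0 <-> exists x, lm x = u.
    split=> [qu0|[x <-]]; last by rewrite /= lE.
    have [x ix] : exists x, i x = (j u).1.
      by apply/exE; rewrite jd [_.2]qu0 linear0.
    by exists x; apply: jI; rewrite lE ix [RHS]surjective_pairing [(j u).2]qu0.
  have [||s sK] := brick_surj_split lrd brB _ qS.
  - by apply: (fg_extension (L := L) (N := B)) fgB => //; exists lm, q.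
  - by move=> u /lex[x <-]; exact: (trace_map lm (gL x)).
  exists ((fst : {linear (E * B)%type -> E}) \o j \o s : {linear B -> E}) => b.
  by rewrite /= jd; congr (f _); apply: sK.
have [x tx pxy] : exists2 x, trace B x & p x = p y.
  apply: (gN (p y) _ (image_submodule p (trace_submodule B E))) => f b.
  by have [h <-] := lift f; exists (h b) => //; apply: trace_im.
have [z iz] : exists z, i z = y - x by apply/exE; rewrite linearB pxy subrr.
rewrite -(subrK x y) -iz.
exact: submoduleD (trace_submodule B E) (trace_map i (gL z)) tx.
Qed.

(** * Modules extracted from completely join-irreducible classes *)

(** A module of [X] outside the lower cover generates a class that is not below [X0], hence not
    strictly below [X], so it is [X] itself. *)
Lemma cji_witness (C : subcat A -> Prop) (X : subcat A) :
  (forall Y, C Y -> pretorsion_class A Y) -> completely_join_irreducible C X ->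
  exists X0, [/\ C X0, exists2 M, X M & ~ X0 M
    & forall N, X N -> ~ X0 N -> C (fac N) -> X = fac N].
Proof.
move=> Cpre [CX _ [X0 [CX0 _ maxX0]]]; exists X0; split=> //.
  apply: contrapT => H; have [_] : subcat_lt X X.
    apply/(maxX0 _ CX) => M XM; apply: contrapT => X0M; apply: H; by exists M.
  by case.
move=> N XN X0N CN; have leX := fac_min (Cpre _ CX) XN.
apply/predeqP => M; split; last exact: leX.
suff [_] : ~ subcat_lt (fac N) X /\ subcat_eq X (fac N) by move=> /(_ M)[].
have nlt : ~ subcat_lt (fac N) X.
  move=> /(maxX0 _ CN)/(_ N) FN; apply/X0N/FN/fac_refl.
  by have [[fgX _] _ _ _] := Cpre _ CX; apply: fgX.
split=> // L; split; last exact: leX.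
move: L; apply: contrapT => neq; apply: nlt; split=> // eqF.
by apply: neq => L /eqF.
Qed.

Lemma cji_indecomposable (C : subcat A -> Prop) (X : subcat A) :
  (forall Y, C Y -> pretorsion_class A Y) -> completely_join_irreducible C X ->
  exists M, [/\ finitely_generated M, indecomposable M
    & C (fac M) -> X = fac M].
Proof.
move=> Cpre cX; have [CX _ _] := cX.
have [X0 [CX0 [M XM X0M] gX]] := cji_witness Cpre cX.
have [[fgX _] _ Xq _] := Cpre _ CX.
have [N [fgN qMN indN X0N]] :=
  indecomposable_summand (Cpre _ CX0) (fgX _ XM) X0M.
by exists N; split=> //; apply: gX => //; apply: Xq XM.
Qed.

(* A module of X outside X0 all of whose proper quotients lie in X0 is a brick:
   otherwise it is an extension of the cokernel by the image of some
   endomorphism, and both are proper quotients. *)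
Lemma torsion_cji_brick (X : subcat A) :
  completely_join_irreducible (torsion_class A) X ->
  exists B, [/\ finitely_generated B, brick B, X B
    & torsion_class A (fac B) -> X = fac B].
Proof.
move=> cX; have [CX _ _] := cX.
have tors_pre Y : torsion_class A Y -> pretorsion_class A Y by case.
have [X0 [CX0 [M XM X0M] gX]] := cji_witness tors_pre cX.
have [[fgX _] _ Xq _] := tors_pre _ CX.
have [[_ X0z _ _] X0ext] := CX0.
suff [B [XB X0B brB]] : exists B, [/\ X B, ~ X0 B & brick B].
  by exists B; split=> //; [apply: fgX|apply: gX].
have fgM := fgX _ XM; move: M fgM XM X0M.
apply: proper_quotient_ind => M fgM IH XM X0M.
have [[N [MN X0N]]|small] := EM (exists N, proper_quotient M N /\ ~ X0 N).
  by apply: (IH N MN) X0N; case: MN => f fS _; apply: Xq XM; exists f.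
exists M; split=> //; split=> [/X0z//|f f0].
have {}small N (p : {linear M -> N}) : surj p -> ~ injective p -> X0 N.
  move=> pS pNI; apply: contrapT => X0N; apply: small; exists N; split=> //.
  by exists p.
have [fI|/not_inj_ker[x fx0 x0]] := EM (injective f).
  exact: linear_inverse fI (inj_surj fgM fI).
(* [I = M / ker f] stands for the image of [f], and [Q] is its cokernel. *)
have [I [p [pS pE]]] := quotient_exists (ker_submodule f).
have [Q [q [qS qE]]] := quotient_exists (im_submodule f).
have [|i iE] := factor_through (h := f) pS; first by move=> y /pE.
case: X0M; apply: (X0ext I M Q).
- exists i, q; split=> //.
    apply: ker0_inj => z; have [y <-] := pS z; rewrite iE; exact: (pE y).2.
  move=> y; split=> [/qE[z <-]|[z <-]]; first by exists (p z).
  by have [t <-] := pS z; apply/qE; exists t.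
- by apply: (small I p) => // pI; apply/x0/(inj_ker0 pI)/pE.
- apply: (small Q q) => // qI; apply: f0 => y.
  by apply: (inj_ker0 qI); apply/qE; exists y.
Qed.

End Dimension.

Theorem theorem3p13 (k : closedFieldType) (A : falgType k) :
  (forall X : subcat A,
     completely_join_irreducible (pretorsion_class A) X <->
     completely_join_irreducible (torsion_class A) X) <->
  locally_representation_directed A.
Proof.
have tors_pre Y : torsion_class A Y -> pretorsion_class A Y by case.
have pre_cji M : finitely_generated M -> indecomposable M ->
    completely_join_irreducible (pretorsion_class A) (fac M).
  move=> fgM indM; apply: fac_cji => //; first by case: indM.
  - exact: fac_pretorsion.
  - exact: zero_pretorsion.
  - exact: fac0_pretorsion.
split=> [coincide M fgM indM|lrd X].
  have /coincide/torsion_cji_brick[B [fgB brB FMB eqF]] := pre_cji M fgM indM.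
  have indB := brick_indecomposable brB.
  (* Coincidence is used a second time, on [fac B], to learn that it is a torsion class and hence
     equals [fac M]. *)
  have [torB _ _] := (coincide _).1 (pre_cji B fgB indB).
  apply: (brick_iso (M := B)) => //; apply: gen_antisym_iso => //.
    by have := fac_refl fgM; rewrite (eqF torB) => -[].
  by case: FMB.
have tors_cji M : finitely_generated M -> indecomposable M ->
    completely_join_irreducible (torsion_class A) (fac M).
  move=> fgM indM; have torM := fac_torsion lrd fgM (lrd M fgM indM).
  apply: fac_cji => //; first by case: indM.
  - exact: zero_torsion.
  - exact: fac0_torsion (lrd M fgM indM) torM.
(* In either lattice [X] is some [fac M], provided [fac M] belongs to the lattice; this proviso is
   the side goal left by each rewriting. *)
split=> [/cji_indecomposable|/cji_indecomposable].
  move=> [//|M [fgM indM ->]]; last exact: fac_pretorsion.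
  exact: tors_cji.
move=> [//|M [fgM indM ->]]; first exact: pre_cji.
exact: fac_torsion (lrd M fgM indM).
Qed.
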